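(* Let $b \leq -2$ be an integer. (1) There is an infinitely long sequence of $3$-consecutive $-2$-happy numbers. In particular, $a\in \mathbb{Z}^+$ is $-2$-happy if and only if $a \equiv 1 \pmod 3$. (2) There is an infinitely long sequence of $2$-consecutive $-3$-happy numbers. In particular, $a\in \mathbb{Z}^+$ is $-3$-happy if and only if $a \equiv 1 \pmod 2$. (3) For $b\in \{-4,-6,-8,-10\}$, there exist arbitrarily long finite sequences of consecutive (i.e., $1$-consecutive) $b$-happy numbers. (4) For $b$ odd, there exist arbitrarily long finite sequences of $2$-consecutive $b$-happy numbers.
   Context: For an integer $b\leq -2$, every nonzero integer $a$ (positive or negative) has a unique base $b$ expansion $a=\sum_{i=0}^n a_i b^i$ with integers $0\leq a_i\leq |b|-1$ and $a_n\neq 0$. Define $S_{2,b}:\mathbb{Z}\to\mathbb{Z}_{\geq 0}$ by $S_{2,b}(0)=0$ and $S_{2,b}(a)=\sum_{i=0}^n a_i^2$ for $a\neq 0$. Write $S_{2,b}^k$ for the $k$-fold iterate of $S_{2,b}$. An integer $a$ is a $b$-happy number if there exists $k\in\mathbb{Z}^+$ (positive integers) with $S_{2,b}^k(a)=1$. A $d$-consecutive sequence is an arithmetic sequence with constant difference $d$. ''Arbitrarily long finite sequences'' means that for every $N\in\mathbb{Z}^+$ there is such a sequence with $N$ terms. *)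

(* Defs.v *)
From HB Require Import structures.
From mathcomp Require Import all_boot all_order all_algebra.
From mathcomp Require Import zify.

Set Implicit Arguments.
Unset Strict Implicit.
Unset Printing Implicit Defensive.

Import Order.TTheory GRing.Theory Num.Theory.
Local Open Scope ring_scope.

(* [s] lists the digits a_0, a_1, ..., a_n of [a], least significant first. *)
Definition is_expansion (b a : int) (s : seq nat) : Prop :=
  [/\ s != [::],
      forall c, c \in s -> (c <= `|b|.-1)%N,
      last 0%N s != 0%N
    & a = \sum_(i < size s) (nth 0%N s i)%:Z * b ^+ i].

(* The remainder [(a %% b)%Z] lies in [0, |b|) also for negative [b], so
   iterated Euclidean division yields the digits; for b <= -2 and a != 0,
   [`|a|.+1] division steps suffice (see [digitsP]). *)
Fixpoint digits_rec (b : int) (fuel : nat) (a : int) : seq nat :=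
  if fuel is n.+1 then
    if a == 0 then [::] else `|(a %% b)%Z|%N :: digits_rec b n (a %/ b)%Z
  else [::].

Definition digits (b a : int) : seq nat := digits_rec b `|a|.+1 a.

Definition S2 (b a : int) : nat :=
  if a == 0 then 0%N else (\sum_(c <- digits b a) c ^ 2)%N.

Definition happy (b a : int) : Prop :=
  exists k : nat, (0 < k)%N /\ iter k (fun x : int => (S2 b x)%:Z) a = 1.

Definition consecutive (d : int) (s : seq int) : Prop :=
  forall i, (i.+1 < size s)%N -> s`_i.+1 = s`_i + d.

Definition infinite_consecutive (d : int) (u : nat -> int) : Prop :=
  forall i, u i.+1 = u i + d.

Definition has_infinite_happy_sequence (d b : int) : Prop :=
  exists u : nat -> int,
    infinite_consecutive d u /\ forall i, happy b (u i).

Definition has_long_happy_sequences (d b : int) : Prop :=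
  forall N : nat, (0 < N)%N ->
  exists s : seq int,
    [/\ size s = N, consecutive d s & forall a, a \in s -> happy b a].

Lemma expansion_cons (b : int) (c : nat) (s : seq nat) :
  \sum_(i < size (c :: s)) (nth 0%N (c :: s) i)%:Z * b ^+ i =
  c%:Z + b * \sum_(i < size s) (nth 0%N s i)%:Z * b ^+ i.
Proof.
rewrite /= big_ord_recl /= expr0 mulr1; congr (_ + _).
rewrite mulr_sumr; apply: eq_bigr => i _.
by rewrite /bump /= add1n exprS mulrCA.
Qed.

Lemma digits_recP (b : int) (n : nat) (a : int) : b <= -2 ->
  a != 0 -> (`|a| < n)%N -> is_expansion b a (digits_rec b n a).
Proof.
move=> hb; elim: n a => [//|n IHn] a a0 an /=; rewrite (negPf a0).
have b0 : b != 0 by lia.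
have hr0 := modz_ge0 a b0; have hrb := ltz_mod a b0.
have ha := divz_eq a b.
set q := (a %/ b)%Z in ha *; set r := (a %% b)%Z in ha hr0 hrb *.
have rE : `|r|%N%:Z = r by lia.
have hc : (`|r| <= `|b|.-1)%N by lia.
have [q0|q0] := eqVneq q 0.
  have -> : digits_rec b n q = [::] by rewrite q0; case: (n).
  split=> //.
  - by move=> c; rewrite inE => /eqP ->.
  - rewrite /=; move: ha a0; rewrite q0 mul0r add0r => ->; lia.
  - by rewrite expansion_cons big_ord0 mulr0 addr0 rE {1}ha q0 mul0r add0r.
have [a2|a1] := leqP 2 `|a|%N.
  have qn : (`|q| < n)%N.
    suff : (`|q| < `|a|)%N by lia.
    nia.
  have [s0 sd sl sE] := IHn _ q0 qn.
  split=> //.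
  - by move=> c; rewrite inE => /orP[/eqP ->|/sd].
  - by move: s0 sl; case: (digits_rec b n q).
  - by rewrite expansion_cons -sE rE {1}ha addrC mulrC.
have aN : a = -1 by nia.
have q1 : q = 1 by nia.
have n0 : (0 < n)%N by lia.
have [m mE] : exists m, n = m.+1 by exists n.-1; lia.
have d1 : digits_rec b n q = [:: 1%N].
  rewrite q1 mE /=.
  have -> : (1 %% b)%Z = 1 by rewrite -modzN modz_small //; lia.
  have -> : (1 %/ b)%Z = 0 by rewrite -[b]opprK divzN divz_small //; lia.
  by case: (m).
rewrite d1; split=> //.
- move=> c; rewrite !inE => /orP[/eqP->//|/eqP->]; lia.
- by rewrite !expansion_cons big_ord0 rE {1}ha q1; lia.
Qed.

Lemma digitsP (b a : int) : b <= -2 -> a != 0 -> is_expansion b a (digits b a).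
Proof. by move=> hb a0; apply: digits_recP. Qed.

Lemma expansion_uniq (b a : int) (s t : seq nat) : b <= -2 ->
  is_expansion b a s -> is_expansion b a t -> s = t.
Proof.
move=> hb [s0 sd sl sE] [t0 td tl tE].
have {s0}sl : last 1%N s != 0%N by case: s s0 sl {sd sE}.
have {t0}tl : last 1%N t != 0%N by case: t t0 tl {td tE}.
have nz u : last 1%N u != 0%N -> (forall c, c \in u -> (c <= `|b|.-1)%N) ->
    \sum_(i < size u) (nth 0%N u i)%:Z * b ^+ i = 0 -> u = [::].
  elim: u => [//|c u IHu] ul ud; rewrite expansion_cons.
  set v := \sum_(i < _) _ => E.
  have hc := ud c (mem_head _ _).
  have v0 : v = 0 by nia.
  have c0 : c = 0%N by nia.
  have u0 : u = [::].
    apply: IHu => //; first by move: ul; case: (u).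
    by move=> d du; apply: ud; rewrite inE du orbT.
  by move: ul; rewrite u0 c0.
elim: s t a sd sl sE td tl tE => [|c s IHs] [|d t] a sd sl sE td tl tE //.
- by rewrite (nz _ tl td) // -tE sE big_ord0.
- by rewrite (nz _ sl sd) // -sE tE big_ord0.
move: sE tE; rewrite !expansion_cons.
set v := \sum_(i < size s) _; set w := \sum_(i < size t) _ => sE tE.
have hc := sd c (mem_head _ _); have hd := td d (mem_head _ _).
have vw : v = w by nia.
have cd : c = d by nia.
rewrite cd; congr (_ :: _); apply: (IHs t v) => //.
- by move=> x xs; apply: sd; rewrite inE xs orbT.
- by move: sl; case: (s).
- by move=> x xt; apply: td; rewrite inE xt orbT.
- by move: tl; case: (t).
Qed.

Lemma S2_expansion (b a : int) (s : seq nat) : b <= -2 ->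
  is_expansion b a s -> a != 0 -> S2 b a = (\sum_(c <- s) c ^ 2)%N.
Proof.
move=> hb hs a0; rewrite /S2 (negPf a0).
by rewrite (expansion_uniq hb (digitsP hb a0) hs).
Qed.

(* Main.v *)
Require Import Defs.
From mathcomp Require Import all_boot all_order all_algebra.
From mathcomp Require Import zify ring.

Set Implicit Arguments.
Unset Strict Implicit.
Unset Printing Implicit Defensive.

Import Order.TTheory GRing.Theory Num.Theory.
Local Open Scope ring_scope.

(** Writing S for S_{2,b}, everything rests on S (q b + r) = r^2 + S q for a
    digit r ([S2_digit]), and on the remark that a block of digits placed far
    enough to the left adds its digit squares and changes nothing else
    ([S2_high], [S2_pad]).

    Bases -2 and -3.  Modulo 3, respectively 2, digits equal their squares and
    b is 1, so S preserves residues; hence a happy number is 1 modulo 3,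
    respectively 2.  Conversely S a < a for all but a few a > 0, so descent
    ends in finitely many starting values, which are computed.

    Long sequences.  Call T simultaneously happy if some translate of T by a
    positive n consists of happy numbers.  If a translate of T, or the image
    of T under S, has this property, so does T: an extra n after applying S is
    obtained before applying it by adding a far-left block whose digits have
    square sum n.  It therefore suffices to send two elements x, y of T to the
    same point by translations and applications of S, and to repeat until a
    single point remains, which is moved to a number with S equal to 1.

    If x - y = v (b - 1), then x and y can be translated to b v and v, which
    have the same nonzero digits ([S2_merge]).  In general one first chooses a
    translation after which S x and S y are congruent modulo b - 1.  With
    D = x - y and gap D A = S (A + D) - S A, this asks for an A such that
    b - 1 divides gap D A.  Peeling digits off D shows that gap D takes, for
    some constant K, all the values K + gap 1 q ([ex_reaches_unit_gap]), and
    gap 1 c = 2 c + 1 for 0 <= c <= |b| - 2 ([gap1]).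

    For b odd and D even, K is odd, and c runs over all residues modulo
    (|b| + 1) / 2, so some c works ([gap_congr_odd]).

    For b even, |b| + 1 is odd and 2 c + 1 misses only the residues -1 and -3;
    so c exists unless K is 1 or 3 modulo b - 1.  If b divides D, a digit 0 is
    dropped; if |D| = 1, then K = 0 is available.  Otherwise the last digit of
    A offers several values of K for the same D, at least one of which is
    neither 1 nor 3.  This works for every even b <= -4 ([gap_congr_even]). *)

(** * Digits and sums of squared digits *)

(** Induction on the expansion rather than on |a|: division by a negative base
    does not always decrease |a|, as -1 = 1 * b + (|b| - 1). *)
Lemma digit_ind (b : int) (P : int -> Prop) : b <= -2 -> P 0 ->
  (forall q (r : nat), (r < `|b|)%N -> P q -> P (q * b + r%:Z)) ->
  forall a, P a.
Proof.
move=> hb P0 PS a; have [->//|a0] := eqVneq a 0.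
have [_ sd _ ->] := digitsP hb a0.
elim: (digits b a) sd => [|c s IHs] sd; first by rewrite big_ord0.
rewrite expansion_cons addrC mulrC; apply: PS.
  have := sd c (mem_head _ _); lia.
by apply: IHs => d ds; apply: sd; rewrite inE ds orbT.
Qed.

Lemma S2_digit (b q : int) (r : nat) : b <= -2 -> (r < `|b|)%N ->
  S2 b (q * b + r%:Z) = (r ^ 2 + S2 b q)%N.
Proof.
move=> hb rb; have [->|q0] := eqVneq q 0.
  rewrite mul0r add0r {2}/S2 eqxx addn0.
  have [->|r0] := eqVneq r 0%N; first by rewrite /S2.
  rewrite (@S2_expansion b r [:: r]) ?big_seq1 //.
  split=> //; last by rewrite expansion_cons big_ord0 mulr0 addr0.
  by move=> c; rewrite inE => /eqP->; lia.
have [s0 sd sl sE] := digitsP hb q0.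
rewrite (@S2_expansion b _ (r :: digits b q)) //; last by nia.
  by rewrite big_cons /(S2 b q) (negPf q0).
split=> //.
- by move=> c; rewrite inE => /orP[/eqP->|/sd //]; lia.
- by move: s0 sl; case: (digits b q).
- by rewrite expansion_cons -sE addrC mulrC.
Qed.

Lemma S2_0 (b : int) : S2 b 0 = 0%N.
Proof. by rewrite /S2 eqxx. Qed.

(** A form of S that evaluates by computation, unlike the big operator. *)
Lemma S2_sumn (b a : int) : S2 b a = sumn [seq (c ^ 2)%N | c <- digits b a].
Proof.
rewrite sumnE big_map /S2; case: eqVneq => // ->.
by rewrite /digits /= big_nil.
Qed.

Lemma S2_small (b : int) (r : nat) : b <= -2 -> (r < `|b|)%N ->
  S2 b r%:Z = (r ^ 2)%N.
Proof. by move=> hb rb; have := S2_digit 0 hb rb; rewrite mul0r add0r S2_0 addn0. Qed.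

Lemma S2_mulX (b y : int) (m : nat) : b <= -2 -> S2 b (y * b ^+ m) = S2 b y.
Proof.
move=> hb; elim: m => [|m IHm]; first by rewrite mulr1.
rewrite exprSr mulrA -[_ * b]addr0 (@S2_digit b _ 0) ?IHm //; lia.
Qed.

(** The digits of y do not overlap those of x once R is at least the number of
    digits of x; a single bound serves a finite set of x. *)
Lemma S2_high (b : int) (T : seq int) : b <= -2 ->
  exists m, forall R (y : int) x, (m <= R)%N -> x \in T ->
    S2 b (x + y * b ^+ R) = (S2 b x + S2 b y)%N.
Proof.
move=> hb; elim: T => [|x T [m IHT]]; first by exists 0%N.
suff [k hk] : exists k, forall R (y : int), (k <= R)%N ->
    S2 b (x + y * b ^+ R) = (S2 b x + S2 b y)%N.
  exists (k + m)%N => R y z le_R; rewrite inE => /orP[/eqP->|zT].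
    by apply: hk; lia.
  by apply: IHT => //; lia.
clear IHT; move: x; apply: (digit_ind hb) => [|q r rb [k hk]].
  by exists 0%N => R y _; rewrite add0r S2_mulX // S2_0.
exists k.+1 => -[//|R] y le_R.
rewrite (_ : q * b + r%:Z + _ = (q + y * b ^+ R) * b + r%:Z); last by rewrite exprSr; ring.
by rewrite !S2_digit // hk // addnA.
Qed.

Lemma S2_surj_pos (b : int) (s : nat) : b <= -2 ->
  exists2 z : int, 0 < z & S2 b z = s.+1.
Proof.
move=> hb; elim: s => [|s [z z0 zE]].
  by exists 1 => //; rewrite (@S2_small b 1) //; lia.
exists (z * b * b + 1%:Z); first by nia.
rewrite S2_digit //; last by lia.
by rewrite -[z * b]addr0 (@S2_digit b z 0) ?zE //; lia.
Qed.

(** Some large y adds exactly s + 1 to S at each point of a finite set.  The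
    exponent of b is taken even so that y is positive. *)
Lemma S2_pad (b : int) (T : seq int) (s : nat) (L : int) : b <= -2 ->
  exists2 y : int, L <= y & forall x, x \in T -> S2 b (x + y) = (S2 b x + s.+1)%N.
Proof.
move=> hb; have [m hm] := S2_high T hb; have [z z0 zE] := S2_surj_pos s hb.
have sqr_b : 4 <= b ^+ 2 by rewrite expr2; nia.
have even_pow k : k%:Z < b ^+ (2 * k).
  by rewrite exprM; elim: k => [|k IHk] //; rewrite [_ ^+ k.+1]exprS; nia.
exists (z * b ^+ (2 * (m + `|L|))).
  by have := even_pow (m + `|L|)%N; nia.
by move=> x xT; rewrite hm ?zE //; lia.
Qed.

(** * Simultaneously happy translates *)

Lemma happy_S2 (b x : int) : happy b (S2 b x)%:Z -> happy b x.
Proof. by case=> k [k0 hk]; exists k.+1; rewrite iterSr. Qed.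

Lemma happy1 (b : int) : b <= -2 -> happy b 1.
Proof. by move=> hb; exists 1%N; rewrite /= (@S2_small b 1) //; lia. Qed.

(** The translation n is positive because it must be realised, one application
    of S earlier, as a nonempty sum of squared digits. *)
Definition simultaneously_happy (b : int) (T : seq int) : Prop :=
  exists2 n : int, 0 < n & forall t, t \in T -> happy b (t + n).

Lemma simultaneously_happy_shift (b m : int) (T : seq int) : 0 <= m ->
  simultaneously_happy b [seq t + m | t <- T] -> simultaneously_happy b T.
Proof.
move=> m0 [n n0 hn]; exists (m + n); first by lia.
by move=> t tT; rewrite addrA; apply/hn/map_f.
Qed.

Lemma simultaneously_happy_S2 (b : int) (T : seq int) : b <= -2 ->
  simultaneously_happy b [seq (S2 b t)%:Z | t <- T] -> simultaneously_happy b T.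
Proof.
move=> hb [n n0 hn].
have [y y1 hy] := S2_pad T `|n|.-1 1 hb.
exists y; first by lia.
move=> t tT; apply: happy_S2; rewrite hy //.
have -> : (S2 b t + `|n|.-1.+1)%:Z = (S2 b t)%:Z + n by lia.
exact/hn/(map_f (fun t => (S2 b t)%:Z)).
Qed.

(** If x - y = v (b - 1), then x and y are translates of v b and v by the same
    amount, and multiplication by b only shifts digits. *)
Lemma S2_merge (b x y : int) : b <= -2 -> (b - 1 %| x - y)%Z ->
  exists2 n : int, 0 <= n & S2 b (x + n) = S2 b (y + n).
Proof.
move=> hb /dvdzP[v hv].
have [Y hY SY] := S2_pad [:: v; v * b] 0 (y - v) hb.
exists (v + Y - y); first by lia.
rewrite (_ : x + _ = v * b + Y); last by rewrite -[x](subrK y) hv; ring.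
rewrite (_ : y + _ = v + Y); last by ring.
by rewrite !SY ?inE ?eqxx ?orbT // -[v * b]addr0 (@S2_digit b v 0) //; lia.
Qed.

(** The effect of S on a difference D; it depends on the position A, and the
    choice of A is what makes two points congruent modulo b - 1. *)
Definition gap (b D A : int) : int := (S2 b (A + D))%:Z - (S2 b A)%:Z.

(** Merging two points of T reduces its size by one.  The congruence modulo d
    restricts the differences for which the gap condition is needed; it
    survives the merging because S preserves residues modulo d. *)
Lemma simultaneously_happy_congr (b d : int) (T : seq int) : b <= -2 ->
  (forall x, (d %| (S2 b x)%:Z - x)%Z) ->
  (forall D, (d %| D)%Z -> exists A, (b - 1 %| gap b D A)%Z) ->
  (forall x y : int, x \in T -> y \in T -> (d %| x - y)%Z) ->
  simultaneously_happy b T.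
Proof.
move=> hb dS hgap; have [n] := ubnP (size T); elim: n T => // n IHn [|x [|y T]] sT dT.
- by exists 1.
- have [Y hY SY] := S2_pad [:: 0] 0 (`|x| + 1) hb.
  exists (Y - x); first by lia.
  move=> t; rewrite inE => /eqP->; apply: happy_S2.
  rewrite (_ : x + _ = 0 + Y); last by ring.
  by rewrite SY ?inE // S2_0; apply: happy1.
have [A hA] : exists A, (b - 1 %| gap b (x - y) A)%Z.
  by apply/hgap/dT; rewrite !inE eqxx ?orbT.
have [Y hY SY] := S2_pad [:: A; A + (x - y)] 0 (y - A) hb.
pose m := A + Y - y.
have m0 : 0 <= m by rewrite /m; lia.
have [n' n'0 hn'] : exists2 n' : int, 0 <= n' &
    S2 b ((S2 b (x + m))%:Z + n') = S2 b ((S2 b (y + m))%:Z + n').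
  apply: S2_merge => //.
  rewrite (_ : x + m = A + (x - y) + Y); last by rewrite /m; ring.
  rewrite (_ : y + m = A + Y); last by rewrite /m; ring.
  rewrite !SY ?inE ?eqxx ?orbT //.
  by rewrite !PoszD opprD addrACA subrr addr0.
(* F is translation by m, then S, then translation by n', then S;
   it takes the same value at x and y. *)
pose F t := (S2 b ((S2 b (t + m))%:Z + n'))%:Z.
have dF t : (d %| F t - (t + m + n'))%Z.
  rewrite (_ : _ - _ = (F t - ((S2 b (t + m))%:Z + n'))
    + ((S2 b (t + m))%:Z - (t + m))); last by ring.
  by apply: rpredD; apply: dS.
suff : simultaneously_happy b [seq F t | t <- x :: T].
  move=> hF; apply: (simultaneously_happy_shift m0).
  apply: simultaneously_happy_S2 => //.
  apply: (simultaneously_happy_shift n'0).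
  apply: simultaneously_happy_S2 => //.
  have [k k0 hk] := hF; exists k => // t; rewrite -!map_comp => /mapP[u uT ->] /=.
  rewrite -/(F u); move: uT; rewrite !inE => /or3P[/eqP->|/eqP->|uT].
  - by apply: hk; rewrite mem_head.
  - by rewrite /F -hn'; apply: hk; rewrite mem_head.
  - by apply: hk; rewrite inE map_f ?orbT.
apply: IHn; first by rewrite size_map.
move=> _ _ /mapP[u uT ->] /mapP[v vT ->].
rewrite (_ : _ - _ = (F u - (u + m + n')) - (F v - (v + m + n')) + (u - v)); last by ring.
apply: rpredD; first by apply: rpredB.
have sub w : w \in x :: T -> w \in [:: x, y & T].
  by rewrite !inE => /orP[->|->]; rewrite ?orbT.
by apply: dT; apply: sub.
Qed.

(** * Gaps modulo b - 1 *)

(** Splitting off the last digits r of A and r' of A + D.  The same difference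
    D can be written with different beta according to whether adding D to A
    produces a carry. *)
Lemma gap_digit (b beta q : int) (r r' : nat) : b <= -2 ->
  (r < `|b|)%N -> (r' < `|b|)%N ->
  gap b (beta * b + (r'%:Z - r%:Z)) (q * b + r%:Z)
    = (r'%:Z ^+ 2 - r%:Z ^+ 2) + gap b beta q.
Proof.
move=> hb rb rb'; rewrite /gap.
rewrite (_ : _ + (_ + _) = (q + beta) * b + r'%:Z); last by ring.
by rewrite !S2_digit // !PoszD -!mulnn !PoszM; ring.
Qed.

Lemma gap1 (b : int) (c : nat) : b <= -2 -> (c.+1 < `|b|)%N ->
  gap b 1 c%:Z = 2 * c%:Z + 1.
Proof.
move=> hb cb; rewrite /gap (_ : c%:Z + 1 = c.+1%:Z); last by lia.
by rewrite !S2_small // -?mulnn; lia.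
Qed.

(** The constant K does not depend on q, which stays free for solving a
    congruence afterwards. *)
Definition reaches_unit_gap (b D K : int) : Prop :=
  forall q, exists A, gap b D A = K + gap b 1 q.

Lemma reaches_unit_gap_digit (b beta K : int) (r r' : nat) : b <= -2 ->
  (r < `|b|)%N -> (r' < `|b|)%N -> reaches_unit_gap b beta K ->
  reaches_unit_gap b (beta * b + (r'%:Z - r%:Z)) ((r'%:Z ^+ 2 - r%:Z ^+ 2) + K).
Proof.
move=> hb rb rb' hK q; have [A hA] := hK q; exists (A * b + r%:Z).
by rewrite gap_digit // hA addrA.
Qed.

(** Peeling off last digits brings every nonzero D to 1.  The pairs of digits
    are chosen so that the remaining difference never becomes 0: if
    1 < D < |b|, the addition is made to carry, which leaves -1, and
    -1 = b + (|b| - 1) leaves 1. *)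
Lemma ex_reaches_unit_gap (b D : int) : b <= -2 -> D != 0 ->
  exists K, reaches_unit_gap b D K.
Proof.
move=> hb; have [n] := ubnP `|D|%N; elim: n D => // n IHn D leD D0.
have unit1 : reaches_unit_gap b 1 0 by move=> q; exists q; rewrite add0r.
have unitN1 := @reaches_unit_gap_digit b 1 0 0 `|b|.-1 hb _ _ unit1.
have D_N1 : 1 * b + (`|b|.-1%:Z - 0%:Z) = -1 by lia.
rewrite D_N1 in unitN1.
have [->|D1] := eqVneq D 1; first by exists 0.
have [->|DN1] := eqVneq D (-1); first by eexists; apply: unitN1; lia.
have b0 : b != 0 by lia.
have hr0 := modz_ge0 D b0; have hrb := ltz_mod D b0.
have hD := divz_eq D b.
set q := (D %/ b)%Z in hD *; set r := (D %% b)%Z in hr0 hrb hD *.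
have [q0|q0] := eqVneq q 0.
  rewrite (_ : D = -1 * b + ((`|r|.-1)%:Z - (`|b|.-1)%:Z)); last by lia.
  by eexists; apply: reaches_unit_gap_digit; [| | | apply: unitN1]; lia.
have [||K hK] := IHn q => //; first by nia.
rewrite hD (_ : q * b + r = q * b + (`|r|%:Z - 0%:Z)); last by lia.
by eexists; apply: reaches_unit_gap_digit; [| | | apply: hK]; lia.
Qed.

(** For d dividing b - 1, a number is congruent to its digit sum modulo d. *)
Lemma S2_congr (b d x : int) : b <= -2 -> (d %| b - 1)%Z ->
  (forall r : nat, (r < `|b|)%N -> (d %| (r ^ 2)%:Z - r%:Z)%Z) ->
  (d %| (S2 b x)%:Z - x)%Z.
Proof.
move=> hb db dr; move: x; apply: (digit_ind hb) => [|q r rb IHq].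
  by rewrite S2_0 subrr.
rewrite S2_digit // PoszD.
rewrite (_ : _ - _ = (r ^ 2)%:Z - r%:Z + ((S2 b q)%:Z - q) - q * (b - 1)).
  by apply: rpredB; [apply: rpredD => //; apply: dr | apply: dvdz_mull].
by ring.
Qed.

Lemma S2_parity (b x : int) : b <= -2 -> odd `|b| -> (2 %| (S2 b x)%:Z - x)%Z.
Proof.
move=> hb ob; apply: S2_congr => //; first by lia.
by move=> r _; have := oddM r r; rewrite andbb -mulnn; set u := (r * r)%N; lia.
Qed.

Lemma gap_congr_odd (b D : int) : b <= -2 -> odd `|b| -> (2 %| D)%Z ->
  exists A, (b - 1 %| gap b D A)%Z.
Proof.
move=> hb ob D2; have [->|D0] := eqVneq D 0.
  by exists 0; rewrite /gap addr0 subrr.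
have [K hK] := ex_reaches_unit_gap hb D0.
have [k kE] : exists k, K = 2 * k - 1.
  (* The gap K + 1 at q = 0 is even, like D, since S preserves parity. *)
  have [A] := hK 0; rewrite (@gap1 b 0) //; last by lia.
  rewrite /gap => hA; have := S2_parity A hb ob; have := S2_parity (A + D) hb ob.
  move: hA; clear -D2; set x := S2 b _; set y := S2 b _ => hA h1 h2.
  by exists ((K + 1) %/ 2)%Z; lia.
(* K + 2 c + 1 = 2 (k + c) and |b| + 1 = 2 h, so c must be - k modulo h; the
   residue is at most h - 1, hence at most |b| - 2 because b <= -3. *)
pose h : int := ((`|b| + 1) %/ 2)%N.
have hE : b = - (2 * h - 1) by rewrite /h; lia.
have h0 : h != 0 by lia.
pose c := `|((- k) %% h)%Z|%N.
have c0 := modz_ge0 (- k) h0; have ch := ltz_mod (- k) h0.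
have [A hA] := hK c%:Z; exists A; rewrite hA gap1 //; last by rewrite /c; lia.
apply/dvdzP; exists ((- k) %/ h)%Z.
have := divz_eq (- k) h; rewrite /c hE; nia.
Qed.

Lemma ndvdz_double (N e : int) : odd `|N| -> 0 < e -> e < N -> ~~ (N %| 2 * e)%Z.
Proof.
move=> oN e0 eN; rewrite Gauss_dvdzr; last by rewrite coprimezE coprimen2.
by rewrite dvdzE; apply/negP => /dvdn_leq; lia.
Qed.

(** Modulo the odd number 1 - b the equation K + 2 c + 1 = 0 has a unique
    solution with 0 <= c <= |b|; the solutions c = |b| and c = |b| - 1, where
    c + 1 is no longer a digit, correspond to K = 1 and K = 3. *)
Lemma gap1_solve (b K : int) : b <= -2 -> ~~ odd `|b| ->
  ~~ (1 - b %| K - 1)%Z -> ~~ (1 - b %| K - 3)%Z ->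
  exists2 c : nat, (c.+1 < `|b|)%N & (b - 1 %| K + (2 * c%:Z + 1))%Z.
Proof.
move=> hb eb K1 K3.
have [m mE] : exists m : int, b = - (2 * m) by exists `|b|./2; lia.
pose N := 2 * m + 1; have NE : 1 - b = N by rewrite mE /N; ring.
have N0 : N != 0 by rewrite /N; lia.
(* m + 1 is the inverse of 2 modulo N. *)
pose x := - ((K + 1) * (m + 1)).
have xE := divz_eq x N; have c0 := modz_ge0 x N0; have cN := ltz_mod x N0.
set t := (x %/ N)%Z in xE; set c := (x %% N)%Z in xE c0 cN.
have cE : K + (2 * c + 1) = - (K + 1 + 2 * t) * N.
  have -> : c = x - t * N by rewrite xE; ring.
  by rewrite /x /N; ring.
have c_big e : c = 2 * m - e -> (1 - b %| K - (1 + 2 * e))%Z.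
  move=> ce; rewrite NE (_ : K - _ = (- (K + 1 + 2 * t) - 2) * N) ?dvdz_mull //.
  by rewrite mulrBl -cE ce /N; ring.
exists `|c|%N; last first.
  rewrite (_ : (`|c|%N : int) = c); last by lia.
  by rewrite cE -[b - 1]opprK opprB NE dvdzE abszN -dvdzE dvdz_mull.
have [cm|cm] := eqVneq c (2 * m).
  by have := c_big 0; rewrite (negPf K1) => /(_ _)/negP; case; lia.
have [cm1|cm1] := eqVneq c (2 * m - 1).
  by have := c_big 1; rewrite (negPf K3) => /(_ _)/negP; case; lia.
by move: cN; rewrite /N; lia.
Qed.

(** Two choices of last digits for the same D give two constants K1 and
    K1 + 2 e.  Both lie in {1, 3} modulo 1 - b only if 2 e is 0, 2 or -2, that
    is, as 1 - b is odd, if e is 0, 1 or -1; the bounds on e exclude this. *)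
Lemma gap_congr_two_starts (b beta : int) (r1 r1' r2 r2' : nat) (e : int) :
  b <= -4 -> ~~ odd `|b| -> beta != 0 ->
  (r1 < `|b|)%N -> (r1' < `|b|)%N -> (r2 < `|b|)%N -> (r2' < `|b|)%N ->
  r1'%:Z - r1%:Z = r2'%:Z - r2%:Z ->
  (r2'%:Z ^+ 2 - r2%:Z ^+ 2) - (r1'%:Z ^+ 2 - r1%:Z ^+ 2) = 2 * e ->
  2 <= e -> e <= - b - 2 ->
  exists A, (b - 1 %| gap b (beta * b + (r1'%:Z - r1%:Z)) A)%Z.
Proof.
move=> hb eb beta0 h1 h1' h2 h2' drr sE e2 eb2.
have hb2 : b <= -2 by lia.
have [K hK] := ex_reaches_unit_gap hb2 beta0.
have R1 := reaches_unit_gap_digit hb2 h1 h1' hK.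
have := reaches_unit_gap_digit hb2 h2 h2' hK; rewrite -drr => R2.
set K1 := (_ + K) in R1; set K2 := (_ + K) in R2.
have K21 : K2 = K1 + 2 * e by rewrite -sE /K1 /K2; ring.
have solve K' : reaches_unit_gap b (beta * b + (r1'%:Z - r1%:Z)) K' ->
    ~~ (1 - b %| K' - 1)%Z -> ~~ (1 - b %| K' - 3)%Z ->
    exists A, (b - 1 %| gap b (beta * b + (r1'%:Z - r1%:Z)) A)%Z.
  move=> hK' n1 n3; have [c cb cE] := gap1_solve hb2 eb n1 n3.
  by have [A hA] := hK' c; exists A; rewrite hA gap1.
have Nodd : odd `|1 - b| by lia.
have nd f : 1 <= f -> f <= - b - 1 -> ~~ (1 - b %| 2 * f)%Z.
  by move=> f1 fb; apply: ndvdz_double => //; lia.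
have [d1|n1] := boolP (1 - b %| K1 - 1)%Z; last first.
  have [d3|n3] := boolP (1 - b %| K1 - 3)%Z; last exact: solve R1 n1 n3.
  apply: (solve _ R2); rewrite K21.
    apply: contra (nd (e + 1) _ _) => [h| |]; [|lia|lia].
    rewrite (_ : 2 * _ = K1 + 2 * e - 1 - (K1 - 3)); last by ring.
    exact: rpredB.
  apply: contra (nd e _ _) => [h| |]; [|lia|lia].
  rewrite (_ : 2 * _ = K1 + 2 * e - 3 - (K1 - 3)); last by ring.
  exact: rpredB.
apply: (solve _ R2); rewrite K21.
  apply: contra (nd e _ _) => [h| |]; [|lia|lia].
  rewrite (_ : 2 * _ = K1 + 2 * e - 1 - (K1 - 1)); last by ring.
  exact: rpredB.
apply: contra (nd (e - 1) _ _) => [h| |]; [|lia|lia].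
rewrite (_ : 2 * _ = K1 + 2 * e - 3 - (K1 - 1)); last by ring.
exact: rpredB.
Qed.

(** By symmetry D > 0; write D = q b + r.  For r = 0, the quotient q is handled
    by induction.  For r = 1 the last digits are added without carry, unless
    D = 1.  For r > 1 they are added with carry, which leaves the nonzero
    difference q - 1 < 0.  In each case the two pairs of digits are chosen to
    give an admissible e in [gap_congr_two_starts]. *)
Lemma gap_congr_even (b D : int) : b <= -4 -> ~~ odd `|b| ->
  exists A, (b - 1 %| gap b D A)%Z.
Proof.
move=> hb eb; have hb2 : b <= -2 by lia.
have [n] := ubnP `|D|%N; elim: n D => // n IHn D leD.
have [->|D0] := eqVneq D 0; first by exists 0; rewrite /gap addr0 subrr.
wlog D_gt0 : D leD D0 / 0 < D.
  move=> wD; have [|D_le0] := boolP (0 < D); first exact: wD.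
  have [A hA] : exists A, (b - 1 %| gap b (- D) A)%Z by apply: wD; lia.
  exists (A - D); rewrite (_ : gap b D (A - D) = - gap b (- D) A) ?rpredN //.
  by rewrite /gap subrK opprB.
have b0 : b != 0 by lia.
have hr0 := modz_ge0 D b0; have hrb := ltz_mod D b0.
have hD := divz_eq D b.
set q := (D %/ b)%Z in hD *; set r := (D %% b)%Z in hr0 hrb hD *.
have q0 : q <= 0 by nia.
have [r0|rn0] := eqVneq r 0.
  have [|A hA] := IHn q; first by nia.
  exists (A * b + 0%:Z).
  have E := @gap_digit b q A 0 0 hb2; rewrite !subrr add0r -r0 -hD in E.
  by rewrite E //; lia.
have [r1|rn1] := eqVneq r 1.
  have [q00|qn0] := eqVneq q 0.
    (* D = 1, and 2 (|b| / 2) + 1 = 1 - b. *)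
    exists (`|b|./2)%:Z; rewrite hD q00 r1 mul0r add0r gap1 //; last by lia.
    by apply/dvdzP; exists (-1); lia.
  rewrite hD r1.
  by apply: (@gap_congr_two_starts b q 0 1 2 3 2) => //; lia.
have qn1 : q - 1 != 0 by lia.
(* The digits |b| - 1 and |b| - 2 would give e = |b| - r = 1 here, hence the
   choice of |b| - 1 and |b| - 3, with e = 2. *)
have [rb|rb] := eqVneq r (- b - 1).
  have [m bE] : exists m, `|b|%N = m.+4 by exists (`|b| - 4)%N; lia.
  rewrite hD (_ : q * b + r = (q - 1) * b + (m.+2%:Z - m.+3%:Z)); last by lia.
  by apply: (@gap_congr_two_starts b _ _ _ m.+1 m 2) => //; lia.
have [k rE] : exists k, r = k.+2%:Z by exists (`|r| - 2)%N; lia.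
have [f bE] : exists f, `|b|%N = (k + f).+2 by exists (`|b| - `|r|)%N; lia.
rewrite hD (_ : q * b + r = (q - 1) * b + (k.+1%:Z - (k + f).+1%:Z)); last by lia.
by apply: (@gap_congr_two_starts b _ _ _ (k + f) k f) => //; lia.
Qed.

(** * Long sequences *)

Lemma long_happy_sequences (b d : int) : b <= -2 ->
  (forall x, (d %| (S2 b x)%:Z - x)%Z) ->
  (forall D, (d %| D)%Z -> exists A, (b - 1 %| gap b D A)%Z) ->
  has_long_happy_sequences d b.
Proof.
move=> hb dS hgap N N0.
have [|n n0 hn] := @simultaneously_happy_congr b d (mkseq (fun i => d * i%:Z) N) hb dS hgap.
  by move=> _ _ /mapP[i _ ->] /mapP[j _ ->]; rewrite -mulrBr dvdz_mulr.
exists (mkseq (fun i => d * i%:Z + n) N); split.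
- by rewrite size_mkseq.
- move=> i; rewrite size_mkseq => iN; rewrite !nth_mkseq //; last by lia.
  by rewrite -addn1 PoszD; ring.
- move=> _ /mapP[i iN ->]; apply: hn.
  exact: (map_f (fun i => d * i%:Z)).
Qed.

(** * Bases -2 and -3 *)

Lemma happy_congr (b d : int) : (forall x, (d %| (S2 b x)%:Z - x)%Z) ->
  forall a, happy b a -> (a = 1 %[mod d])%Z.
Proof.
move=> dS a [k [_ hk]]; apply/eqP; rewrite -hk eqz_mod_dvd.
elim: k {hk} => [|k IHk]; first by rewrite subrr.
rewrite iterS (_ : a - _ = (a - iter k (fun x => (S2 b x)%:Z) a)
   - ((S2 b (iter k (fun x => (S2 b x)%:Z) a))%:Z - iter k (fun x => (S2 b x)%:Z) a)).
  by apply: rpredB.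
by ring.
Qed.

(** Above L the map S decreases and preserves the residue class, so the
    question reduces to the finitely many numbers below L. *)
Lemma happy_descent (b d L : int) : (forall x, (d %| (S2 b x)%:Z - x)%Z) ->
  (forall a, 0 < a -> a < L -> (a = 1 %[mod d])%Z -> happy b a) ->
  (forall a, L <= a -> (S2 b a)%:Z < a) ->
  (forall a, 0 < a -> 0 < (S2 b a)%:Z) ->
  forall a, 0 < a -> (a = 1 %[mod d])%Z -> happy b a.
Proof.
move=> dS small lt_S gt_S a; have [n] := ubnP `|a|%N.
elim: n a => // n IHn a lean a0 a1.
have [aL|La] := ltP a L; first exact: small.
apply: happy_S2; apply: IHn; [|exact: gt_S|].
  have := lt_S a La; lia.
by rewrite -a1; apply/eqP; rewrite eqz_mod_dvd.
Qed.

Lemma S2_gt0 (b a : int) : b <= -2 -> a != 0 -> (0 < S2 b a)%N.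
Proof.
move=> hb; move: a; apply: (digit_ind hb) => [|q r rb IHq] a0 //.
rewrite S2_digit // addn_gt0; case: r rb a0 => [|r] // rb; rewrite addr0 => a0.
by rewrite IHq //; apply: contraNneq a0 => ->; rewrite mul0r.
Qed.

(** If q <= -2, then S (- 2 q + r) = r + S q <= r + |q| + 1 < - 2 q + r.  The
    sharper bound S a <= a for a >= 0 is needed to reprove S a <= |a| + 1
    at a = -2 + r. *)
Lemma S2_base2_lt (a : int) : 4 <= a -> (S2 (-2) a)%:Z < a.
Proof.
suff [_ _ lt] : [/\ (S2 (-2) a)%:Z <= `|a| + 1, 0 <= a -> (S2 (-2) a)%:Z <= a
  & 4 <= a -> (S2 (-2) a)%:Z < a].
  exact: lt.
have hb : (-2 : int) <= -2 by [].
move: a; apply: (digit_ind hb) => [|q r rb [le1 le2 _]].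
  by rewrite S2_0.
rewrite S2_digit // -mulnn; have [->|->] : r = 0%N \/ r = 1%N by lia.
  by split; lia.
by split; lia.
Qed.

(** The bound S a <= |a| + 4 passes from q to - 3 q + r when |q| >= 3; for
    smaller q the values of S q are computed.  For q <= -4, that is, for
    - 3 q + r >= 12, the same estimate gives S (- 3 q + r) < - 3 q + r. *)
Lemma S2_base3_lt (a : int) : 12 <= a -> (S2 (-3) a)%:Z < a.
Proof.
suff [_ lt] : (S2 (-3) a)%:Z <= `|a| + 4 /\ (12 <= a -> (S2 (-3) a)%:Z < a).
  exact: lt.
have hb : (-3 : int) <= -2 by [].
move: a; apply: (digit_ind hb) => [|q r rb [le1 _]].
  by rewrite S2_0.
have small : [/\ S2 (-3) (-2) = 2%N, S2 (-3) (-1) = 5%N, S2 (-3) 0 = 0%N,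
  S2 (-3) 1 = 1%N & S2 (-3) 2 = 4%N] by split; rewrite S2_sumn; vm_compute.
have qE : q = -2 \/ q = -1 \/ q = 0 \/ q = 1 \/ q = 2 \/ 3 <= `|q| by lia.
rewrite S2_digit // -mulnn.
have {rb} : r = 0%N \/ r = 1%N \/ r = 2%N by lia.
case: small qE le1 => hN2 hN1 h0 h1 h2 [->|[->|[->|[->|[->|hq]]]]];
  rewrite ?(hN2, hN1, h0, h1, h2) => le1 [->|[->|->]]; split; lia.
Qed.

Lemma happy_base2 (a : int) : 0 < a -> (happy (-2) a <-> (a = 1 %[mod 3])%Z).
Proof.
have dS x : (3 %| (S2 (-2) x)%:Z - x)%Z.
  by apply: S2_congr => // r rb; have [->|->] : r = 0%N \/ r = 1%N by lia.
move=> a0; split; first exact: happy_congr.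
apply: (happy_descent dS _ S2_base2_lt) => // {a0}a.
  move=> a0 a4 a1; have -> : a = 1 by lia.
  exact: happy1.
by move=> a0; rewrite ltz_nat S2_gt0 //; lia.
Qed.

Lemma happy_base3 (a : int) : 0 < a -> (happy (-3) a <-> (a = 1 %[mod 2])%Z).
Proof.
have dS x : (2 %| (S2 (-3) x)%:Z - x)%Z by apply: S2_parity.
move=> a0; split; first exact: happy_congr.
apply: (happy_descent dS _ S2_base3_lt) => // {a0}a; last first.
  by move=> a0; rewrite ltz_nat S2_gt0 //; lia.
move=> a0 a12 a1.
have : a = 1 \/ a = 3 \/ a = 5 \/ a = 7 \/ a = 9 \/ a = 11 by lia.
(* 1 -> 1, 3 -> 5 -> 9 -> 1, 7 -> 3 and 11 -> 5. *)
by case=> [->|[->|[->|[->|[->|->]]]]]; [exists 1%N | exists 3%N | exists 2%N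
  | exists 4%N | exists 1%N | exists 3%N]; split=> //=; rewrite !S2_sumn; vm_compute.
Qed.

Theorem theorem5 (b : int) (hb : b <= -2) :
  [/\ has_infinite_happy_sequence 3 (-2) /\
      (forall a : int, 0 < a -> (happy (-2) a <-> (a = 1 %[mod 3])%Z)),
      has_infinite_happy_sequence 2 (-3) /\
      (forall a : int, 0 < a -> (happy (-3) a <-> (a = 1 %[mod 2])%Z)),
      b \in [:: -4; -6; -8; -10] -> has_long_happy_sequences 1 b
    & odd `|b|%N -> has_long_happy_sequences 2 b].
Proof.
have arith_seq (d : int) (i : nat) : d * i.+1%:Z + 1 = d * i%:Z + 1 + d.
  by rewrite -addn1 PoszD; ring.
split.
- split; last exact: happy_base2.
  exists (fun i : nat => 3 * i%:Z + 1); split=> [i|i]; first exact: arith_seq.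
  by apply/happy_base2; lia.
- split; last exact: happy_base3.
  exists (fun i : nat => 2 * i%:Z + 1); split=> [i|i]; first exact: arith_seq.
  by apply/happy_base3; lia.
- move=> b_even; apply: long_happy_sequences => // D _.
  by apply: gap_congr_even; move: b_even; rewrite !inE => /or4P[]/eqP->.
- move=> b_odd; apply: long_happy_sequences => // [x|D D2].
    exact: S2_parity.
  exact: gap_congr_odd.
Qed.
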